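(* Let $\mathfrak p=(p_i)_{i=1}^\infty$ be a sequence of monic real-rooted polynomials such that $p_i$ has degree $d_i$ with $d_i\to\infty$, with infinitesimal distribution $(\mu,\mu')$, and let $q_i=p_i'$ be the polynomial obtained by differentiating $p_i$ once. Then the sequence $\mathfrak q=(q_i)_{i=1}^\infty$ has infinitesimal distribution $(\nu,\nu')$, where $\nu=\mu$ and $$\nu'=\mu'+\mu-\mathcal M(\mu),$$ with $\mathcal M(\mu)$ the inverse Markov–Krein transform of $\mu$.
   Context: For a polynomial $p$ of degree $d\ge1$ with roots $\lambda_1,\dots,\lambda_d$ (with multiplicity), $m_n(p)=\frac1d\sum_k\lambda_k^n$. A sequence $(p_i)_{i\ge1}$ of real-rooted polynomials with degrees $d_i\to\infty$ has infinitesimal distribution $(\mu,\mu')$ if $\mu$ is a probability distribution on $\mathbb R$ with finite moments $m_n(\mu)=\int t^n\,d\mu(t)$ of all orders, $m_n(p_i)\to m_n(\mu)$ as $i\to\infty$ for all $n\ge0$, the limits $\lim_{i\to\infty}d_i\,(m_n(p_i)-m_n(\mu))$ exist for all $n\ge1$, and $\mu':\mathbb R[x]\to\mathbb R$ is the linear functional with $\mu'(1)=0$ whose value at $x^n$ is this limit. (For the sequence $(q_i)$ the degree is $d_i-1$; $q_i$ need not be normalized to be monic.) The equality $\nu'=\mu'+\mu-\mathcal M(\mu)$ is one of linear functionals on $\mathbb R[x]$, $\mu$ being identified with $x^n\mapsto m_n(\mu)$. The inverse Markov–Krein transform $\mathcal M(\mu)$ is determined by its Cauchy transform $G_{\mathcal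 M(\mu)}=-\frac{G_\mu'}{G_\mu}$, where $G_\mu(z)=\sum_{n\ge0}m_n(\mu)z^{-n-1}$ as a formal power series; i.e. $\mathcal M(\mu)$ is the functional with $\sum_{n\ge0}\mathcal M(\mu)(x^n)z^{-n-1}=-G_\mu'(z)/G_\mu(z)$. *)

(* Defs.v *)
From HB Require Import structures.
From mathcomp Require Import all_boot all_order all_algebra.
From mathcomp Require Import all_classical all_reals all_analysis.

Set Implicit Arguments.
Unset Strict Implicit.
Unset Printing Implicit Defensive.

Import Order.TTheory GRing.Theory Num.Theory numFieldNormedType.Exports.

Local Open Scope classical_set_scope.
Local Open Scope ring_scope.

Section RealRooted.
Context {R : realType}.
Implicit Types (p : {poly R}) (s : seq R) (n : nat).

Definition degree p : nat := (size p).-1.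

(* For p != 0 this says that s lists the roots of p with multiplicity. *)
Definition root_list p s : Prop :=
  p = lead_coef p *: \prod_(x <- s) ('X - x%:P).

Definition real_rooted p : Prop := p != 0 /\ exists s, root_list p s.

(* A choice of ordering of the roots; by [poly_momentE] moments do not depend
   on it. *)
Definition roots p : seq R := xget [::] [set s | root_list p s].

Definition poly_moment p n : R :=
  (degree p)%:R^-1 * \sum_(x <- roots p) x ^+ n.

Lemma root_list_size p s : p != 0 -> root_list p s -> size s = degree p.
Proof.
move=> p0 ps; rewrite /degree {1}ps size_scale ?lead_coef_eq0//.
by rewrite size_prod_XsubC.
Qed.

Lemma poly_momentE p s n : p != 0 -> root_list p s ->
  poly_moment p n = (degree p)%:R^-1 * \sum_(x <- s) x ^+ n.
Proof.
move=> p0 ps; congr (_ * _); apply: perm_big.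
have rs : root_list p (roots p) by rewrite /roots; case: xgetP => // /(_ s).
apply: prod_XsubC_eq; apply: (@scalerI _ _ (lead_coef p)).
  by rewrite lead_coef_eq0.
by rewrite -rs.
Qed.

End RealRooted.

Section Functionals.
Context {R : realType}.
Implicit Types (a b : nat -> R) (p : {poly R}) (phi : {scalar {poly R}}).

(* The linear functional on R[x] with 'X^n |-> a n. *)
Definition functional_of a p : R := \sum_(i < size p) p`_i * a i.

Lemma functional_of_widen a p n : (size p <= n)%N ->
  functional_of a p = \sum_(i < n) p`_i * a i.
Proof.
move=> pn; rewrite /functional_of (big_ord_widen n (fun i => p`_i * a i) pn).
rewrite big_mkcond /=; apply: eq_bigr => i _; case: ltnP => // ip.
by rewrite nth_default// mul0r.
Qed.

Fact functional_of_is_scalar a : scalar (functional_of a).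
Proof.
move=> c p q; set n := maxn (size p) (size q).
rewrite !(@functional_of_widen a _ n) ?leq_maxl ?leq_maxr//; last first.
  by rewrite (leq_trans (size_polyD _ _))// geq_max leq_maxr andbT
    (leq_trans (size_scale_leq _ _))// leq_maxl.
rewrite mulr_sumr -big_split /=; apply: eq_bigr => i _.
by rewrite coefD coefZ mulrDl mulrA.
Qed.

HB.instance Definition _ a := GRing.isLinear.Build R {poly R} R *%R
  (functional_of a) (functional_of_is_scalar a).

Lemma functional_ofXn a n : functional_of a 'X^n = a n.
Proof.
rewrite /functional_of size_polyXn (bigD1 ord_max)//= coefXn eqxx mul1r.
rewrite big1 ?addr0// => i /negP ni; rewrite coefXn.
case: eqP => [e|_]; last by rewrite mul0r.
by case: ni; apply/eqP/val_inj.
Qed.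

(* A formal power series in z^-1 is represented by the function a : nat -> R
   giving the coefficient a k of z^-k. *)
Definition zseries_mul a b : nat -> R :=
  fun k => \sum_(i < k.+1) a i * b (k - i)%N.

Definition zseries_opp a : nat -> R := fun k => - a k.

(* d/dz, that is, (z^-j)' = - j z^-(j+1). *)
Definition zseries_deriv a : nat -> R :=
  fun k => if k is j.+1 then - (j%:R * a j) else 0.

(* G_a(z) = \sum_n a n z^-(n+1) *)
Definition cauchy_series a : nat -> R := fun k => if k is n.+1 then a n else 0.

(* G_phi = - G_a' / G_a, with the denominator cleared: R[[z^-1]] is an integral
   domain. *)
Definition is_inverse_Markov_Krein a phi : Prop :=
  zseries_mul (cauchy_series (fun n => phi 'X^n)) (cauchy_series a) =
  zseries_opp (zseries_deriv (cauchy_series a)).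

Lemma is_inverse_Markov_KreinE a phi : is_inverse_Markov_Krein a phi <->
  forall n, \sum_(i < n.+1) phi 'X^i * a (n - i)%N = n.+1%:R * a n.
Proof.
have mulE n : zseries_mul (cauchy_series (fun n => phi 'X^n)) (cauchy_series a)
    n.+2 = \sum_(i < n.+1) phi 'X^i * a (n - i)%N.
  rewrite /zseries_mul big_ord_recl big_ord_recr /= mul0r add0r.
  rewrite /bump /= add1n subnn mulr0 addr0; apply: eq_bigr => i _.
  by rewrite add1n subSS subSn// -ltnS.
split=> [e n|e].
  by rewrite -mulE e /zseries_opp /= opprK.
apply/funext => -[|[|n]].
- by rewrite /zseries_mul big_ord1 /= /zseries_opp /= mul0r oppr0.
- rewrite /zseries_mul big_ord_recl big_ord1 /= /zseries_opp /=.
  by rewrite mul0r mulr0 add0r mul0r !oppr0.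
- by rewrite mulE e /zseries_opp /= opprK.
Qed.

Lemma inverse_Markov_Krein_exists a : a 0%N = 1 ->
  exists phi, is_inverse_Markov_Krein a phi.
Proof.
move=> a0.
pose next s : R := (size s).+1%:R * a (size s) -
  \sum_(i < size s) s`_i * a (size s - i)%N.
pose pre := fix pre n : seq R :=
  if n is m.+1 then rcons (pre m) (next (pre m)) else [::].
pose h n := next (pre n).
have szpre n : size (pre n) = n by elim: n => //= n IH; rewrite size_rcons IH.
have nthpre n i : (i < n)%N -> (pre n)`_i = h i.
  elim: n => //= n IH; rewrite ltnS leq_eqVlt nth_rcons szpre => /predU1P[->|lt].
    by rewrite ltnn eqxx.
  by rewrite lt IH.
exists (functional_of h); apply/is_inverse_Markov_KreinE => n.
rewrite big_ord_recr /= subnn a0 mulr1 functional_ofXn /h /next szpre.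
rewrite (eq_bigr (fun i : 'I_n => (pre n)`_i * a (n - i)%N)); last first.
  by move=> i _; rewrite functional_ofXn nthpre.
by rewrite addrC subrK.
Qed.

Lemma inverse_Markov_Krein_unique a phi psi : a 0%N = 1 ->
  is_inverse_Markov_Krein a phi -> is_inverse_Markov_Krein a psi ->
  phi =1 psi.
Proof.
move=> a0 /is_inverse_Markov_KreinE ephi /is_inverse_Markov_KreinE epsi.
have eX n : phi 'X^n = psi 'X^n.
  elim/ltn_ind: n => n IH; move: (ephi n); rewrite -(epsi n).
  rewrite !big_ord_recr /= subnn a0 !mulr1.
  rewrite (eq_bigr (fun i : 'I_n => psi 'X^i * a (n - i)%N)).
    by move/addrI.
  by move=> i _; rewrite IH.
move=> p; rewrite -[p]coefK poly_def !linear_sum; apply: eq_bigr => i _.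
by rewrite !linearZ /= eX.
Qed.

End Functionals.

Section Measures.
Context {R : realType}.
Implicit Type mu : probability (measurableTypeR R) R.

Definition finite_moments mu : Prop :=
  forall n, mu.-integrable [set: R] (fun t : R => (t ^+ n)%:E).

Definition moment mu (n : nat) : R := \int[mu]_t (t ^+ n).

Lemma moment0 mu : moment mu 0 = 1.
Proof.
rewrite /moment /Rintegral (eq_integral (fun=> 1%:E)); last first.
  by move=> x _; rewrite expr0.
by rewrite integral_cst//= mul1e probability_setT.
Qed.

(* mu regarded as a functional on R[x] *)
Definition moment_functional mu : {scalar {poly R}} :=
  functional_of (moment mu).

Definition inverse_Markov_Krein mu : {scalar {poly R}} :=
  projT1 (cid (inverse_Markov_Krein_exists (moment0 mu))).

Lemma inverse_Markov_KreinP mu :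
  is_inverse_Markov_Krein (moment mu) (inverse_Markov_Krein mu).
Proof. exact: (projT2 (cid (inverse_Markov_Krein_exists (moment0 mu)))). Qed.

(* The moments of the finitely many p i of degree < 1 are irrelevant here. *)
Definition has_infinitesimal_distribution (p : nat -> {poly R})
    mu (mu' : {scalar {poly R}}) : Prop :=
  [/\ forall i, real_rooted (p i),
      (fun i => degree (p i)) @ \oo --> \oo,
      finite_moments mu,
      forall n : nat, (fun i => poly_moment (p i) n) @ \oo --> moment mu n &
      mu' 1 = 0 /\
      forall n : nat, (0 < n)%N ->
        (fun i => (degree (p i))%:R * (poly_moment (p i) n - moment mu n))
          @ \oo --> mu' 'X^n].

End Measures.

(* Main.v *)
Require Import Defs.
From HB Require Import structures.
From mathcomp Require Import all_boot all_order all_algebra.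
From mathcomp Require Import all_classical all_reals all_analysis.
From mathcomp Require Import polyorder complex ring zify.

Set Implicit Arguments.
Unset Strict Implicit.
Unset Printing Implicit Defensive.

Import Order.TTheory GRing.Theory Num.Theory numFieldNormedType.Exports.

Local Open Scope classical_set_scope.
Local Open Scope ring_scope.

(** Let p have degree d, let P n be the sum of the nth powers of its roots and Q n
that of the roots of p'.  The formal Cauchy series of the moments of p is
G = p' / (d p), and the logarithmic derivative of this quotient is
G' / G = p'' / p' - p' / p, that is,

  \sum_n (P n - Q n) z^-(n+1) = - G' / G.

So, before any limit is taken, the difference of the two unnormalized root
distributions is exactly the inverse Markov-Krein transform of the root
distribution of p.  In terms of coefficients ([psum_deriv_Markov_Krein]) this is
a recurrence which expresses P n - Q n polynomially in the moments of p of
order at most n, hence P n - Q n converges to M(mu)(x^n) as soon as these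
moments converge ([cvg_inverse_Markov_Krein]).  Since Q n = (d - 1) m_n(p'),

  (d - 1) (m_n(p') - m_n(mu))
    = d (m_n(p) - m_n(mu)) + m_n(mu) - (P n - Q n),

whose right-hand side tends to mu'(x^n) + m_n(mu) - M(mu)(x^n).  Dividing by
d - 1 shows that m_n(p') has the same limit as m_n(p).

That p' is real-rooted is the Gauss-Lucas theorem over the algebraic closure:
at a non-real z all the terms of p'(z) / p(z) = \sum_x 1 / (z - x) have
imaginary parts of the same strict sign ([gauss_lucas_real]). *)

(** * Power sums of the roots of a polynomial and of its derivative *)

Definition psum (R : pzSemiRingType) (s : seq R) (n : nat) : R :=
  \sum_(x <- s) x ^+ n.

(** The first N terms of the Cauchy series \sum_k psum s k z^-(k+1), multiplied
by z^N so as to be a polynomial. *)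
Definition cauchy_trunc (R : nzRingType) (s : seq R) (N : nat) : {poly R} :=
  \poly_(j < N) psum s (N.-1 - j).

Lemma size_sub_leq (R : nzRingType) (p q : {poly R}) (n : nat) :
  (size p <= n)%N -> (size q <= n)%N -> (size (p - q)%R <= n)%N.
Proof.
by move=> pn qn; rewrite (leq_trans (size_polyD _ _))// size_polyN geq_max pn.
Qed.

Lemma cauchy_trunc_cons (R : comNzRingType) (x : R) (s : seq R) (N : nat) :
  ('X - x%:P) * cauchy_trunc (x :: s) N =
  'X^N - (x ^+ N)%:P + ('X - x%:P) * cauchy_trunc s N.
Proof.
have -> : 'X^N - (x ^+ N)%:P =
    ('X - x%:P) * \poly_(j < N) x ^+ (N.-1 - j) :> {poly R}.
  rewrite -opprB polyC_exp subrXX -mulNr opprB poly_def; congr (_ * _).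
  by apply: eq_bigr => j _; rewrite -polyC_exp mul_polyC.
rewrite -mulrDr; congr (_ * _); apply/polyP => j.
rewrite !coefE; case: ifP => _; last by rewrite addr0.
by rewrite /psum big_cons.
Qed.

(** With p'/p the Cauchy series of s, this says that [cauchy_trunc s N] is
'X^N * p' / p up to a series without nonnegative powers of z: truncated series
are handled as exact polynomial identities with a remainder of small degree. *)
Lemma size_cauchy_trunc_rem (R : comNzRingType) (s : seq R) (N : nat) :
  let p := \prod_(x <- s) ('X - x%:P) in
  (size ('X^N * p^`() - p * cauchy_trunc s N)%R <= size s)%N.
Proof.
elim: s => [|x s IH] /=.
  rewrite big_nil derivC mulr0 mul1r sub0r size_polyN size_poly_leq0.
  by apply/eqP/polyP => j; rewrite !coefE /psum big_nil if_same.
rewrite big_cons; set p := \prod_(y <- s) _ in IH *; simpl in IH.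
have sp : size p = (size s).+1 by rewrite size_prod_XsubC.
rewrite derivM derivXsubC mul1r.
have -> : 'X^N * (p + ('X - x%:P) * p^`()) -
    ('X - x%:P) * p * cauchy_trunc (x :: s) N =
  x ^+ N *: p - - (('X - x%:P) * ('X^N * p^`() - p * cauchy_trunc s N)).
  rewrite -mulrA (mulrC p) mulrA cauchy_trunc_cons -mul_polyC; ring.
apply: size_sub_leq; first by rewrite (leq_trans (size_scale_leq _ _)) ?sp.
by rewrite size_polyN (leq_trans (size_polyMleq _ _))// size_XsubC.
Qed.

(** Coefficientwise form of G H = G^2 + G', where G = p'/p and H = p''/p'.  With A
and B the truncations of G and H to N = n.+1 terms, the polynomial E below is
the truncated G H - G^2 - G', multiplied by 'X^(2 * N).  Multiplying it by p and
substituting the remainders r and r2 of A and B cancels all the leading terms;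
what is left has too small a degree for E to have a coefficient of degree n,
and that coefficient is the stated identity. *)
Lemma psum_deriv_Markov_Krein (R : idomainType) (s t : seq R) (c : R) (n : nat) :
  (\prod_(x <- s) ('X - x%:P))^`() = c *: \prod_(y <- t) ('X - y%:P) ->
  size s = (size t).+1 ->
  \sum_(i < n.+1) (psum s i - psum t i) * psum s (n - i) =
  n.+1%:R * psum s n.
Proof.
set p := \prod_(x <- s) _; set q := \prod_(y <- t) _ => dp st.
pose A := cauchy_trunc s n.+1; pose B := cauchy_trunc t n.+1.
pose r := 'X^(n.+1) * p^`() - p * A.
pose r2 := 'X^(n.+1) * p^`()^`() - p^`() * B.
have sr : (size r <= (size t).+1)%N.
  by rewrite -st; exact: size_cauchy_trunc_rem.
have sr2 : (size r2 <= size t)%N.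
  rewrite /r2 dp derivZ -scalerAr -scalerAl -scalerBr.
  by rewrite (leq_trans (size_scale_leq _ _))//; exact: size_cauchy_trunc_rem.
have sA u : (size (cauchy_trunc u n.+1 : {poly R}) <= n.+1)%N.
  exact: size_poly.
have sp : size p = (size t).+2 by rewrite size_prod_XsubC st.
pose E := A * B - A * A - 'X^(n.+1) * A^`() + n.+1%:R *: ('X^n * A).
have pE : p * E = (r * A - r * B) -
    ('X^(n.+1) * r2 - ('X^(n.+1) * r^`() - n.+1%:R *: ('X^n * r))).
  rewrite /E /r2 /r derivB !derivM derivXn /= -!mul_polyC polyC_natr -mulr_natr.
  ring.
have sE : (size E <= n)%N.
  have [->|E0] := eqVneq E 0; first by rewrite size_poly0.
  suff : (size (p * E)%R <= (size t).+1 + n)%N.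
    by rewrite size_monicM ?monic_prod_XsubC// sp /= leq_add2l.
  have sM (u v : {poly R}) a b : (size u <= a.+1)%N -> (size v <= b)%N ->
      (size (u * v)%R <= a + b)%N.
    by move=> ua vb; rewrite (leq_trans (size_polyMleq _ _)); lia.
  have sX k : (size ('X^k : {poly R}) <= k.+1)%N by rewrite size_polyXn.
  have sr' : (size r^`() <= size t)%N.
    have [->|r0] := eqVneq r 0; first by rewrite deriv0 size_poly0.
    by rewrite -ltnS (leq_trans _ sr) ?lt_size_deriv.
  rewrite pE; apply: size_sub_leq; first apply: size_sub_leq.
  - by rewrite addSnnS; apply: sM (sA _).
  - by rewrite addSnnS; apply: sM (sA _).
  apply: size_sub_leq; first by rewrite addSnnS addnC; apply: sM (sX _) _.
  apply: size_sub_leq; first by rewrite addSnnS addnC; apply: sM (sX _) _.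
  rewrite (leq_trans (size_scale_leq _ _))// addnC; exact: sM.
(* E involves A^`() only through a multiple of 'X^(n.+1), which has no
   coefficient of degree n. *)
have : E`_n = 0 by rewrite nth_default.
have coefA u j : (j <= n)%N ->
    (cauchy_trunc u n.+1 : {poly R})`_j = psum u (n - j).
  by move=> jn; rewrite coef_poly ltnS jn.
rewrite /E coefD !coefB coefZ !coefXnM ltnSn ltnn subnn subr0 !coefM.
rewrite coefA// subn0 => /eqP; rewrite -opprB addrC subr_eq0 => /eqP ->.
rewrite -sumrB; apply: eq_bigr => i _.
have iN : (i <= n)%N by rewrite -ltnS.
by rewrite !coefA ?leq_subr// !subKn// -mulrBr mulrC.
Qed.

(** * Real-rootedness of the derivative *)

Lemma horner_deriv_prod_XsubC (F : fieldType) (s : seq F) (z : F) : z \notin s ->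
  let p := \prod_(x <- s) ('X - x%:P) in
  p^`().[z] = p.[z] * \sum_(x <- s) (z - x)^-1.
Proof.
elim: s => [|x s IH]; first by rewrite /= !big_nil derivC horner0 mulr0.
rewrite in_cons negb_or => /andP[zx /IH]; rewrite !big_cons /= => {}IH.
rewrite derivM derivXsubC mul1r hornerD !hornerM IH hornerXsubC.
by field; rewrite subr_eq0.
Qed.

(** Multiplying by Im z gives the imaginary parts of all the (z - x)^-1 a common
sign, whichever half-plane z lies in. *)
Lemma Im_inv_sub (F : rcfType) (z : F[i]) (x : F) : complex.Im z != 0 ->
  0 < - (complex.Im z * complex.Im (z - x%:C%C)^-1).
Proof.
case: z => a b /= b0; rewrite subr0 mulrN opprK mulrA -expr2.
apply: divr_gt0; first by rewrite exprn_even_gt0.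
by rewrite ltr_wpDl ?sqr_ge0// exprn_even_gt0.
Qed.

Lemma Im_sum (F : rcfType) (I : Type) (s : seq I) (f : I -> F[i]) :
  complex.Im (\sum_(i <- s) f i) = \sum_(i <- s) complex.Im (f i).
Proof. exact: (big_morph (@complex.Im F) (raddfD _) erefl). Qed.

(** Let p be the product.  A non-real root z of p' is not a root of p, so \sum_x (z - x)^-1 = 0, although
the imaginary parts of its terms all have the strict sign opposite to Im z. *)
Lemma gauss_lucas_real (F : rcfType) (s : seq F) (z : F[i]) : s != [::] ->
  root (map_poly (real_complex F) (\prod_(x <- s) ('X - x%:P)))^`() z ->
  complex.Im z = 0.
Proof.
move=> s0; rewrite rmorph_prod/=.
under eq_bigr do rewrite rmorphB/= map_polyX map_polyC/=.
rewrite -(big_map (real_complex F) predT (fun x => 'X - x%:P)) => rz.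
apply/eqP/contraT => Iz.
have zs : z \notin map (real_complex F) s.
  by apply/mapP => -[x _ zE]; move: Iz; rewrite zE eqxx.
move: rz; rewrite rootE horner_deriv_prod_XsubC// mulf_eq0 -rootE root_prod_XsubC.
rewrite (negbTE zs) /= big_map => /eqP S0.
suff : 0 < - (complex.Im z * complex.Im (\sum_(x <- s) (z - x%:C%C)^-1)).
  by rewrite S0 /= mulr0 oppr0 ltxx.
case: s s0 {zs S0} => // x s _.
rewrite Im_sum mulr_sumr -sumrN big_cons ltr_pwDl ?Im_inv_sub// sumr_ge0// => y _.
by rewrite ltW// Im_inv_sub.
Qed.

(** The derivative splits over the algebraically closed field F[i], and its roots
there all lie in F, so the splitting descends to F. *)
Lemma deriv_prod_XsubC_split (F : rcfType) (s : seq F) : s != [::] ->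
  exists t : seq F, size s = (size t).+1 /\
  (\prod_(x <- s) ('X - x%:P))^`() =
    (size s)%:R *: \prod_(x <- t) ('X - x%:P).
Proof.
set p := \prod_(x <- s) _ => s0.
have sp : size p = (size s).+1 by rewrite size_prod_XsubC.
have lp : lead_coef p^`() = (size s)%:R.
  rewrite lead_coefE size_deriv sp /=.
  rewrite coef_deriv prednK ?lt0n ?size_eq0//.
  by have /monicP := monic_prod_XsubC s xpredT id; rewrite lead_coefE sp /= => ->.
have [r pr] := closed_field_poly_normal (map_poly (real_complex F) p^`()).
have rr z : z \in r -> complex.Im z = 0.
  move=> zr; apply: (gauss_lucas_real s0); rewrite deriv_map pr.
  rewrite rootE hornerZ mulf_eq0 orbC -rootE root_prod_XsubC.
  by rewrite zr.
have dp : p^`() = (size s)%:R *: \prod_(x <- map (@complex.Re F) r) ('X - x%:P).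
  apply: (map_poly_inj (real_complex F)); rewrite pr map_polyZ lead_coef_map lp.
  congr (_ *: _); rewrite rmorph_prod big_map; apply: eq_big_seq => z zr.
  rewrite rmorphB/= map_polyX map_polyC/=; congr ('X - _%:P).
  by move: (rr z zr); case: z {zr} => a b /= ->.
exists (map (@complex.Re F) r); split=> //.
have := congr1 (fun u : {poly F} => size u) dp.
by rewrite size_deriv sp size_scale ?size_prod_XsubC// pnatr_eq0 size_eq0.
Qed.

(** * Moments *)

(** A polynomial of degree 0 is covered because it has no roots; so the derivative
of a polynomial of degree 1 needs no separate treatment. *)
Lemma degree_poly_moment (R : realType) (p : {poly R}) (s : seq R) (n : nat) :
  p != 0 -> root_list p s -> (degree p)%:R * poly_moment p n = psum s n.
Proof.
move=> p0 ps; rewrite (poly_momentE n p0 ps) -(root_list_size p0 ps).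
case: s ps => [|x s] _; first by rewrite mul0r /psum big_nil.
by rewrite mulVKf// pnatr_eq0.
Qed.

Lemma poly_moment0 (R : realType) (p : {poly R}) :
  real_rooted p -> (0 < degree p)%N -> poly_moment p 0 = 1.
Proof.
move=> [p0 [s ps]] dp; rewrite (poly_momentE 0 p0 ps).
under eq_bigr do rewrite expr0.
by rewrite big_const_seq count_predT iter_addr_0 (root_list_size p0 ps)
  mulVf// pnatr_eq0 -lt0n.
Qed.

Lemma degree_deriv (R : realType) (p : {poly R}) :
  degree p^`() = (degree p).-1.
Proof. by rewrite /degree size_deriv. Qed.

(** The recurrence is the one that characterizes the inverse Markov-Krein transform
of the moments of p: at finite degree, deg p * m(p) - deg p' * m(p') is that
transform. *)
Lemma real_rooted_deriv (R : realType) (p : {poly R}) :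
  real_rooted p -> (0 < degree p)%N -> real_rooted p^`() /\
  forall n, \sum_(i < n.+1)
      ((degree p)%:R * poly_moment p i -
       (degree p^`())%:R * poly_moment p^`() i) * poly_moment p (n - i) =
    n.+1%:R * poly_moment p n.
Proof.
move=> [p0 [s ps]] dp; have ss := root_list_size p0 ps.
have s0 : s != [::] by rewrite -size_eq0 ss -lt0n.
have [t [st dt]] := deriv_prod_XsubC_split s0.
have p'0 : p^`() != 0 by rewrite -size_poly_gt0 size_deriv.
have p't : root_list p^`() t.
  rewrite /root_list ps derivZ dt !lead_coefZ !(monicP (monic_prod_XsubC _ _ _)).
  by rewrite !mulr1 scalerA.
split=> [|n]; first by split=> //; exists t.
under eq_bigr do
  rewrite (degree_poly_moment _ p0 ps) (degree_poly_moment _ p'0 p't).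
have d0 : (degree p)%:R != 0 :> R by rewrite pnatr_eq0 -lt0n.
apply: (mulfI d0); rewrite mulr_sumr mulrCA (degree_poly_moment _ p0 ps).
rewrite -(psum_deriv_Markov_Krein n dt st); apply: eq_bigr => i _.
by rewrite mulrCA (degree_poly_moment _ p0 ps).
Qed.

(** Continuity of the inverse Markov-Krein transform for the convergence of moments:
as a x 0 = 1, the recurrence solves for h x n as a polynomial in the a x i and
the previous h x i. *)
Lemma cvg_inverse_Markov_Krein (R : realType) (T : Type) (F : set_system T)
    (FF : Filter F) (a h : T -> nat -> R) (b k : nat -> R) :
  (forall x, a x 0%N = 1) -> b 0%N = 1 ->
  (forall x n, \sum_(i < n.+1) h x i * a x (n - i)%N = n.+1%:R * a x n) ->
  (forall n, \sum_(i < n.+1) k i * b (n - i)%N = n.+1%:R * b n) ->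
  (forall n, a x n @[x --> F] --> b n) ->
  forall n, h x n @[x --> F] --> k n.
Proof.
move=> a0 b0 ha kb ab; elim/ltn_ind => n IH.
have -> : k n = n.+1%:R * b n - \sum_(i < n) k i * b (n - i)%N.
  by rewrite -kb big_ord_recr /= subnn b0 mulr1 addrAC subrr add0r.
have -> : (fun x => h x n) =
    (fun x => n.+1%:R * a x n - \sum_(i < n) h x i * a x (n - i)%N).
  apply/funext => x.
  by rewrite -ha big_ord_recr /= subnn a0 mulr1 addrAC subrr add0r.
apply: cvgB; first by apply: cvgM; [exact: cvg_cst|exact: ab].
apply: cvg_big => [|i _]; first exact: add_continuous.
by apply: cvgM; [exact: IH|exact: ab].
Qed.

Theorem corollary5p7 (R : realType) (p : nat -> {poly R})
    (mu : probability (measurableTypeR R) R) (mu' : {scalar {poly R}})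
    (p_monic : forall i, p i \is monic)
    (p_degree : forall i, (1 <= degree (p i))%N)
    (p_dist : has_infinitesimal_distribution p mu mu') :
  exists (nu : probability (measurableTypeR R) R) (nu' : {scalar {poly R}}),
    [/\ has_infinitesimal_distribution (fun i => (p i)^`()) nu nu',
        nu = mu &
        forall f : {poly R},
          nu' f = mu' f + moment_functional mu f - inverse_Markov_Krein mu f].
Proof.
have [rr doo mom cvm [mu'1 cvmu']] := p_dist.
pose nu' : {scalar {poly R}} :=
  mu' \+ moment_functional mu \- inverse_Markov_Krein mu.
exists mu, nu'; split=> //.
have M := (is_inverse_Markov_KreinE _ _).1 (inverse_Markov_KreinP mu).
pose h i n : R := (degree (p i))%:R * poly_moment (p i) n -
  (degree (p i)^`())%:R * poly_moment (p i)^`() n.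
have hM n : h i n @[i --> \oo] --> inverse_Markov_Krein mu 'X^n.
  have a0 i : poly_moment (p i) 0 = 1 by exact: poly_moment0.
  have rec i := (real_rooted_deriv (rr i) (p_degree i)).2.
  exact: (@cvg_inverse_Markov_Krein R nat \oo _ (fun i => poly_moment (p i)) h
    (moment mu) (fun k => inverse_Markov_Krein mu 'X^k) a0 (moment0 mu) rec M).
have nu'X n : nu' 'X^n =
    mu' 'X^n + moment mu n - inverse_Markov_Krein mu 'X^n.
  by rewrite /nu' /= /moment_functional functional_ofXn.
have cvmu'0 n : (degree (p i))%:R * (poly_moment (p i) n - moment mu n)
    @[i --> \oo] --> mu' 'X^n.
  (* At n = 0 the sequence is constantly 0, which is mu' 1. *)
  case: n => [|n]; last exact: cvmu'.
  rewrite expr0 mu'1 moment0; under eq_fun do rewrite poly_moment0// subrr mulr0.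
  exact: cvg_cst.
have cvnu' n : (degree (p i)^`())%:R * (poly_moment (p i)^`() n - moment mu n)
    @[i --> \oo] --> nu' 'X^n.
  rewrite nu'X; under eq_fun => i.
    rewrite (_ : _ * _ = (degree (p i))%:R * (poly_moment (p i) n - moment mu n)
      + moment mu n - h i n); last first.
      rewrite /h degree_deriv -[in (degree (p i))%:R](prednK (p_degree i)) -natr1.
      ring.
    over.
  by apply: cvgB (hM n); apply: cvgD; [exact: cvmu'0|exact: cvg_cst].
have d'oo : (fun i => degree (p i)^`()) @ \oo --> \oo.
  apply/cvgnyPge => A; move/cvgnyPge : doo => /(_ A.+1); apply: filterS => i.
  by rewrite degree_deriv; lia.
split => //.
- by move=> i; exact: (real_rooted_deriv (rr i) (p_degree i)).1.
- move=> n.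
  have inv0 : (degree (p i)^`())%:R^-1 @[i --> \oo] --> (0 : R).
    apply/gtr0_cvgV0; last exact/cvgrnyP.
    move/cvgnyPge : d'oo => /(_ 1%N); apply: filterS => i.
    by rewrite ltr0n.
  (* m_n(p') is recovered from its rescaled deviation once deg p' is nonzero. *)
  have : moment mu n + (degree (p i)^`())%:R^-1 *
      ((degree (p i)^`())%:R * (poly_moment (p i)^`() n - moment mu n))
      @[i --> \oo] --> moment mu n + 0 * nu' 'X^n.
    by apply: cvgD; [exact: cvg_cst|exact: cvgM].
  rewrite mul0r addr0; apply: cvg_trans; apply: near_eq_cvg.
  move/cvgnyPge : d'oo => /(_ 1%N); apply: filterS => i d0.
  by rewrite mulKf ?pnatr_eq0 -?lt0n// addrC subrK.
- split=> [|n _]; last exact: cvnu'.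
  rewrite -(expr0 'X) nu'X expr0 mu'1 moment0 add0r.
  by move: (M 0%N); rewrite big_ord1 /= moment0 expr0 !mulr1 => ->; rewrite subrr.
Qed.
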